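(* For every $s>0$ there exists a constant $C(s)\in(0,\infty)$, depending only on $s$, such that for every metric space $(X,d)$, $$2^{-s}\mathcal P^{s}(F)\le \mathcal M^{s}(F)\le C(s)\,\mathcal P^{s}(F)\qquad\text{for all } F\subset X,$$ where $\mathcal P^s$ is the $s$-dimensional packing measure and $\mathcal M^s$ is the labelled packing measure. In particular, setting $\dim_{\mathcal M}F:=\inf\{t>0:\mathcal M^{t}(F)=0\}$, one has $\dim_{\mathcal M}F=\dim_P F$ for every $F\subset X$.
   Context: Let $(X,d)$ be a metric space with completion $\widehat X$ (the metric of $\widehat X$ is also denoted $d$). $B(x,r)=\{y\in X:d(x,y)\le r\}$ is the closed ball in $X$; each ball carries its given centre and radius. $|E|$ is the diameter of $E\subset X$, with $|\varnothing|=0$ and $|E|=\infty$ allowed; $\overline E^{\widehat X}$ is the closure of $E$ in $\widehat X$. $\inf\varnothing=\infty$, and empty sums are $0$. A packing is a finite or countable pairwise disjoint family of closed balls. For $s>0$, $\delta\in(0,\infty]$, $E\subset X$, $$\mathcal P^{s}_{\delta}(E):=\sup\Big\{\sum_i(2r_i)^s:\{B(x_i,r_i)\}_i\text{ is a packing},\ x_i\in E,\ 0<r_i<\infty,\ r_i\le\delta\Big\},$$ $\mathcal P^s_0(E):=\inf_{\delta>0}\mathcal P^s_\delta(E)$, and $$\mathcal P^s(F):=\inf\Big\{\sum_{j=1}^\infty\mathcal P^s_0(F_j):F\subseteq\bigcup_{j=1}^\infty F_j\Big\}.$$ The packing dimension is $\dim_PF=\inf\{t>0:\mathcal P^t(F)=0\}$.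 For $s>0$, nonempty $E\subset X$ and $0<R<\infty$ with $|E|\le R$, the local packing cost is $$\Phi^s(E,R):=\sup\Big\{\sum_{i=1}^N(2r_i)^s: N\ge1,\ x_i\in\overline E^{\widehat X},\ 0<r_i\le R,\ d(x_i,x_j)\ge r_i+r_j\ (i\ne j)\Big\},$$ and $\Phi^s(\varnothing,R):=0$. For $0<\delta<\infty$ and $F\subset X$, $$\mathcal M^s_\delta(F):=\inf\Big\{\sum_{j=1}^\infty\Phi^s(E_j,R_j):F\subseteq\bigcup_{j=1}^\infty E_j,\ |E_j|\le R_j\le\delta,\ R_j>0\Big\},$$ and the labelled packing measure is $\mathcal M^s(F):=\lim_{\delta\downarrow0}\mathcal M^s_\delta(F)=\sup_{0<\delta<1}\mathcal M^s_\delta(F)$. *)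

(* Defs.v *)
From HB Require Import structures.
From mathcomp Require Import all_boot all_order all_algebra.
From mathcomp Require Import all_classical all_reals all_analysis.

Set Implicit Arguments.
Unset Strict Implicit.
Unset Printing Implicit Defensive.

Import Order.TTheory GRing.Theory Num.Theory.
Import numFieldNormedType.Exports.

Local Open Scope classical_set_scope.
Local Open Scope ring_scope.

(* Library pitfalls: [closed_ball] is the closure of an open ball, which in a
   metric space may be smaller than the closed ball [mball]; [completeType] is
   a pointed structure, hence excludes the empty space. *)

Section metric_notions.
Context {R : realType}.
Implicit Types X Y : metricType R.

Definition mball X (x : X) (r : R) : set X := [set y | mdist x y <= r].

(* The added 0 only matters for |set0| = 0. *)
Definition diam X (E : set X) : \bar R :=
  ereal_sup (0%E |` [set (mdist p.1 p.2)%:E | p in E `*` E]).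

Record is_completion X Y (i : X -> Y) : Prop := IsCompletion {
  completion_isometry : forall x y, mdist (i x) (i y) = mdist x y ;
  completion_dense : dense (range i) ;
  completion_complete : forall G : set_system Y,
    ProperFilter G -> cauchy G -> exists l : Y, G --> l
}.

End metric_notions.

Section completion_exists.
Context {R : realType} (X : metricType R).

(* The points of the completion are the uniform limits of the functions
   [mdist x], with the distance of uniform convergence. *)
Definition dist_limit (f : X -> R) : Prop :=
  forall e, 0 < e -> exists x, forall y, `|f y - mdist x y| <= e.

Definition dist_completion := {f : X -> R | dist_limit f}.
HB.instance Definition _ := gen_eqMixin dist_completion.
HB.instance Definition _ := gen_choiceMixin dist_completion.
Implicit Types f g h : dist_completion.

Definition unif_dist f g : R := sup [set `|sval f y - sval g y| | y in setT].

Lemma mdist_lip (x y z : X) : `|mdist x z - mdist y z| <= mdist x y.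
Proof.
rewrite ler_norml lerBlDr metric_triangle andbT lerNl opprB lerBlDr.
by rewrite (metric_sym x y) metric_triangle.
Qed.

Lemma unif_dist_has_sup f g : has_sup [set `|sval f y - sval g y| | y in setT].
Proof.
have [x fx] := svalP f _ ltr01; have [x' gx'] := svalP g _ ltr01.
split; first by exists `|sval f x - sval g x|, x.
exists (1 + (mdist x x' + 1)) => _ [y _ <-].
apply: le_trans (ler_distD (mdist x y) _ _) _; apply: lerD => //.
apply: le_trans (ler_distD (mdist x' y) _ _) _; rewrite lerD ?mdist_lip//.
by rewrite distrC.
Qed.

Lemma unif_dist_leP f g e :
  unif_dist f g <= e <-> forall y, `|sval f y - sval g y| <= e.
Proof.
have [ne ub] := unif_dist_has_sup f g; split=> [fge y|fge].
  by apply: le_trans fge; apply: ub_le_sup => //; exists y.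
by apply: ge_sup => // _ [y _ <-].
Qed.

Lemma unif_dist_ub f g y : `|sval f y - sval g y| <= unif_dist f g.
Proof. by have /unif_dist_leP := lexx (unif_dist f g); exact. Qed.

Lemma unif_distxx f : unif_dist f f = 0.
Proof.
have [[_ [y _ _]] _] := unif_dist_has_sup f f.
apply/eqP; rewrite eq_le (le_trans _ (unif_dist_ub f f y)) ?normr_ge0// andbT.
by apply/unif_dist_leP => z; rewrite subrr normr0.
Qed.

Lemma unif_dist_positivity f g : unif_dist f g = 0 -> f = g.
Proof.
case: f g => [f fP] [g gP] fg0; apply: eq_exist; apply/funext => y.
by apply/eqP; rewrite -subr_eq0 -normr_le0 -fg0 (unif_dist_ub (exist _ f fP) (exist _ g gP)).
Qed.

Lemma unif_dist_sym f g : unif_dist f g = unif_dist g f.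
Proof.
by congr sup; apply/eq_imagel => y _; rewrite distrC.
Qed.

Lemma unif_dist_triangle g f h :
  unif_dist f h <= unif_dist f g + unif_dist g h.
Proof.
apply/unif_dist_leP => y; apply: le_trans (ler_distD (sval g y) _ _) _.
by rewrite lerD ?unif_dist_ub.
Qed.

HB.instance Definition _ := @isMetric.Build R dist_completion unif_dist
  unif_distxx unif_dist_positivity unif_dist_sym unif_dist_triangle.

Lemma dist_limit_mdist (x : X) : dist_limit (mdist x).
Proof. by move=> e e0; exists x => y; rewrite subrr normr0 ltW. Qed.

Definition to_completion (x : X) : dist_completion :=
  exist _ _ (dist_limit_mdist x).

Lemma dist_completionP : is_completion to_completion.
Proof.
split.
- move=> x y; apply/eqP; rewrite eq_le; apply/andP; split.
    by apply/unif_dist_leP => z; exact: mdist_lip.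
  have := unif_dist_ub (to_completion x) (to_completion y) y.
  by rewrite /= mdistxx subr0 ger0_norm ?mdist_ge0.
- move=> O [f Of] oO.
  have /nbhs_ballP[e /= e0 eO] := open_nbhs_nbhs (conj oO Of).
  have [|x fx] := svalP f (e / 2); first by rewrite divr_gt0.
  exists (to_completion x); split; last by exists x.
  apply: eO; rewrite ballEmdist /=; apply: (@le_lt_trans _ _ (e / 2)).
    exact/unif_dist_leP.
  by rewrite ltr_pdivrMr// ltr_pMr// ltr1n.
move=> G GF /cauchy_ballP Gc.
have Gex e : 0 < e -> exists g, \forall h \near G, unif_dist g h < e.
  move=> e0; have [[A B] /= [GA GB] AB] := Gc e e0.
  have [a Aa] := filter_ex GA; exists a.
  apply: filterS GB => b Bb.
  by have := AB (a, b) (conj Aa Bb); rewrite /= ballEmdist.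
have Gcvg y : cvg (sval h y @[h --> G]).
  apply: cauchy_cvg; apply: cauchy_exP => e e0.
  have [g Gg] := Gex _ e0; exists (sval g y).
  apply: filterS Gg => h gh; apply: le_lt_trans gh.
  exact: unif_dist_ub.
pose l y := lim (sval h y @[h --> G]).
have lclose g e : (\forall h \near G, unif_dist g h < e) ->
    forall y, `|sval g y - l y| <= e.
  move=> Gg y.
  have : `|sval g y - sval h y| @[h --> G] --> `|sval g y - l y|.
    by apply: cvg_norm; apply: cvgB; [exact: cvg_cst|exact: Gcvg].
  move/cvg_lim => <- //.
  apply: limr_le.
    by apply: is_cvg_norm; apply: is_cvgB; [exact: is_cvg_cst|exact: Gcvg].
  by apply: filterS Gg => h /ltW; apply: le_trans; exact: unif_dist_ub.
have lP : dist_limit l.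
  move=> e e0; have e20 : 0 < e / 2 by rewrite divr_gt0.
  have [g /lclose gl] := Gex _ e20; have [x gx] := svalP g _ e20.
  exists x => y; rewrite (splitr e).
  by apply: le_trans (ler_distD (sval g y) _ _) _; rewrite lerD// distrC.
exists (exist _ l lP : dist_completion).
move=> A /nbhs_ballP[e /= e0 eA].
have e20 : 0 < e / 2 by rewrite divr_gt0.
have [g Gg] := Gex _ e20.
apply: (filterS _ Gg) => h gh.
apply: eA; rewrite ballEmdist /= (splitr e).
apply: le_lt_trans (unif_dist_triangle g _ _) _.
apply: ler_ltD => //; apply/unif_dist_leP => y /=.
by rewrite distrC; exact: lclose Gg y.
Qed.

End completion_exists.

Lemma completion_exists (R : realType) (X : metricType R) :
  exists (Y : metricType R) (i : X -> Y), is_completion i.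
Proof.
by exists (dist_completion X), (@to_completion _ X); exact: dist_completionP.
Qed.

Section packing_measure.
Context {R : realType} {X : metricType R}.
Implicit Types (s : R) (E F : set X).
Local Open Scope ereal_scope.

(* A ball is its label (centre, radius).  A set of labels loses nothing with
   respect to an indexed family: balls of positive radius are nonempty, so the
   labels of a pairwise disjoint family are distinct. *)
Definition is_packing (D : set (X * R)) : Prop :=
  countable D /\ trivIset D (fun b => mball b.1 b.2).

Definition packing_pre s (delta : \bar R) E : \bar R :=
  ereal_sup [set \esum_(b in D) ((2 * b.2) `^ s)%:E | D in
    [set D : set (X * R) | is_packing D /\
      forall b, D b -> [/\ E b.1, (0 < b.2)%R & b.2%:E <= delta]]].

Definition packing_pre0 s E : \bar R :=
  ereal_inf [set packing_pre s delta E | delta in [set delta | 0 < delta]].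

Definition packing_measure s F : \bar R :=
  ereal_inf [set \sum_(0 <= j <oo) packing_pre0 s (F_ j) | F_ in
    [set F_ : nat -> set X | F `<=` \bigcup_j F_ j]].

Definition packing_dim F : \bar R :=
  ereal_inf [set t%:E | t in
    [set t : R | (0 < t)%R /\ packing_measure t F = 0]].

End packing_measure.

Section labelled_packing_measure.
Context {R : realType} {X Y : metricType R}.
Implicit Types (i : X -> Y) (s r delta : R) (E F : set X).
Local Open Scope ereal_scope.

Definition local_packing_cost i s E r : \bar R :=
  if E == set0 then 0 else
  ereal_sup [set c | exists N (x : 'I_N -> Y) (rho : 'I_N -> R),
    [/\ (0 < N)%N,
        forall k, closure (i @` E) (x k),
        forall k, (0 < rho k <= r)%R,
        forall k l, k != l -> (rho k + rho l <= mdist (x k) (x l))%R &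
        c = \sum_(k < N) ((2 * rho k) `^ s)%:E]].

Definition labelled_packing_pre i s delta F : \bar R :=
  ereal_inf [set \sum_(0 <= j <oo) local_packing_cost i s (c.1 j) (c.2 j) |
    c in [set c : (nat -> set X) * (nat -> R) |
      F `<=` \bigcup_j c.1 j /\
      forall j, [/\ diam (c.1 j) <= (c.2 j)%:E,
                    (c.2 j <= delta)%R & (0 < c.2 j)%R]]].

Definition labelled_packing_measure i s F : \bar R :=
  ereal_sup [set labelled_packing_pre i s delta F |
    delta in [set delta : R | (0 < delta < 1)%R]].

Definition labelled_packing_dim i F : \bar R :=
  ereal_inf [set t%:E | t in
    [set t : R | (0 < t)%R /\ labelled_packing_measure i t F = 0]].

Lemma labelled_packing_pre_le i s delta delta' F : (delta <= delta')%R ->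
  labelled_packing_pre i s delta' F <= labelled_packing_pre i s delta F.
Proof.
move=> dd'; apply: ereal_inf_le_tmp; apply: image_subset => c [Fc cP].
split=> // j; have [diamc rd r0] := cP j.
by split=> //; exact: le_trans dd'.
Qed.

Lemma labelled_packing_measure_cvg i s F :
  labelled_packing_pre i s delta F @[delta --> 0%R^'+]
    --> labelled_packing_measure i s F.
Proof.
have -> : labelled_packing_measure i s F =
    ereal_sup ((labelled_packing_pre i s)^~ F @` [set` `]0%R, 1%R[]).
  by congr (ereal_sup (_ @` _)); apply/seteqP; split=> d /=; rewrite in_itv.
apply: (nonincreasing_at_right_cvge (BLeft 1%R)) => [|d d' _ _];
  first by rewrite bnd_simp.
exact: labelled_packing_pre_le.
Qed.

End labelled_packing_measure.

(* Main.v *)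
(* Upper bound: at each point of a set E of finite packing premeasure there are
   arbitrarily small radii r at which the cost of E near x, as a function of the
   scale, is doubling with a constant depending only on s; otherwise the costs
   would decay faster than the contribution r^s of a single ball.  A Vitali
   selection of disjoint balls B(x, r) among these gives a cover of E by the
   enlarged balls, whose costs are comparable to those of E in B(x, r/2).  The
   latter are almost attained by packings inside the disjoint balls B(x, r),
   which merge into one packing of E.  Points of the completion are replaced by
   nearby points of E at the price of halving the radii, so only the isometry
   of X into its completion matters. *)

Require Import Defs.
From HB Require Import structures.
From mathcomp Require Import all_boot all_order all_algebra.
From mathcomp Require Import finmap.
From mathcomp Require Import all_classical all_reals all_analysis.
From mathcomp Require Import ring lra.
Set Implicit Arguments.
Unset Strict Implicit.
Import Order.TTheory GRing.Theory Num.Theory.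
Import numFieldNormedType.Exports.
Local Open Scope classical_set_scope.
Local Open Scope ring_scope.

(** * Sums of nonnegative extended reals over arbitrary index sets *)

Section esum_complements.
Context {R : realType}.
Local Open Scope ereal_scope.

Lemma ge0_le_esumZl {T : choiceType} (D : set T) (a : T -> \bar R) (c : R) :
  (0 <= c)%R -> (forall t, 0 <= a t) ->
  \esum_(t in D) (c%:E * a t) <= c%:E * \esum_(t in D) a t.
Proof.
move=> c0 a0; apply: ge_ereal_sup => _ [A [finA AD] <-].
rewrite -ge0_mule_fsumr//.
apply: lee_wpmul2l; first by rewrite lee_fin.
by apply: esum_ge; exists A.
Qed.

Lemma esum_ge0_le_finite {T : choiceType} (D : set T) (a : T -> \bar R) M :
  (forall t, 0 <= a t) ->
  (forall A, finite_set A -> A `<=` D -> \esum_(t in A) a t <= M) ->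
  \esum_(t in D) a t <= M.
Proof.
move=> a0 aM; apply: ge_ereal_sup => _ [A [finA AD] <-].
by rewrite -esum_fset//; exact: aM.
Qed.

(** Both sides are sums over the pairs [(i, j)]; disjointness makes the second projection injective
    on these pairs. *)
Lemma esum_bigcup_disjoint {T U : choiceType} (I : set T) (J : T -> set U)
    (a : U -> \bar R) : (forall u, 0 <= a u) -> trivIset I J ->
  \esum_(i in I) \esum_(j in J i) a j = \esum_(j in \bigcup_(i in I) J i) a j.
Proof.
move=> a0 tJ; rewrite (esum_esum (a := fun _ u => a u))//.
rewrite -(@esum_image _ _ _ (I `*`` J) snd).
  congr (esum _ _); apply/seteqP; split=> [_ [[i j] [/= Ii Jij] <-]|j [i Ii Jij]].
    by exists i.
  by exists (i, j).
move=> [i j] [i' j'] /[!inE] -[/= Ii Jij] [/= Ii' Jij'] /= jj'; subst j'.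
by rewrite (tJ i i')//; exists j.
Qed.

End esum_complements.

(** * Packings and their weights *)

Section packing_weight.
Context {R : realType} {X : metricType R}.
Implicit Types (s r : R) (E F : set X) (D A : set (X * R)).
Local Open Scope ereal_scope.

Definition packing_weight s D : \bar R :=
  \esum_(b in D) ((2 * b.2) `^ s)%:E.

Lemma packing_weight_ge0 s D : 0 <= packing_weight s D.
Proof. by apply: esum_ge0 => b _; rewrite lee_fin powR_ge0. Qed.

Lemma mball_center (x : X) r : (0 <= r)%R -> mball x r x.
Proof. by rewrite /mball /= mdistxx. Qed.

(** Otherwise the centre of [c] would lie in both balls. *)
Lemma trivIset_mball_lt D b c :
  trivIset D (fun b => mball b.1 b.2) -> D b -> D c -> b != c -> (0 <= c.2)%R ->
  (b.2 < mdist b.1 c.1)%R.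
Proof.
move=> /trivIsetP tD Db Dc bc c0; rewrite ltNge; apply/negP => cb.
have : (mball b.1 b.2 `&` mball c.1 c.2) c.1 by split=> //; exact: mball_center.
by rewrite tD.
Qed.

Lemma packing_weight_le_pre s delta E D : is_packing D ->
  (forall b, D b -> [/\ E b.1, (0 < b.2)%R & b.2%:E <= delta]) ->
  packing_weight s D <= packing_pre s delta E.
Proof. by move=> Dp DE; apply: ereal_sup_ubound; exists D. Qed.

Lemma packing_pre_ge0 s delta E : 0 <= packing_pre s delta E.
Proof.
rewrite -(@esum_set0 R _ (fun b : X * R => ((2 * b.2) `^ s)%:E)).
by apply: packing_weight_le_pre => //; split; [exact: countable0|move=> ? ? []].
Qed.

Lemma packing_pre_le s delta delta' E E' : E `<=` E' -> delta <= delta' ->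
  packing_pre s delta E <= packing_pre s delta' E'.
Proof.
move=> EE' dd'; apply: ge_ereal_sup => _ [D [Dp DE] <-].
apply: packing_weight_le_pre => // b /DE[/EE' ? ? ?]; split => //.
exact: le_trans dd'.
Qed.

Lemma packing_pre0_ge0 s E : 0 <= packing_pre0 s E.
Proof. by apply: le_ereal_inf_tmp => _ [d _ <-]; exact: packing_pre_ge0. Qed.

Lemma packing_measure_ge0 s F : 0 <= packing_measure s F.
Proof.
apply: le_ereal_inf_tmp => _ [F_ _ <-].
by apply: nneseries_ge0 => j _ _; exact: packing_pre0_ge0.
Qed.

End packing_weight.

(** * Local packing cost versus packing premeasure *)

Section local_cost.
Context {R : realType} {X Y : metricType R}.
Variables (i : X -> Y) (iso : forall x y, mdist (i x) (i y) = mdist x y).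
Variable s : R.
Implicit Types (r : R) (E F : set X) (D A : set (X * R)).
Local Open Scope ereal_scope.

Lemma closure_image_approx E y e : closure (i @` E) y -> (0 < e)%R ->
  exists2 x, E x & (mdist (i x) y < e)%R.
Proof.
move=> Ey e0; have /Ey[_ [[x Ex <-]]] : nbhs y (ball y e) by exact: nbhsx_ballx.
by rewrite ballEmdist /= metric_sym; exists x.
Qed.

(** The configuration of one ball of full radius [r] is admissible. This lower bound is what
    prevents the costs near [x] from decaying too fast. *)
Lemma local_packing_cost_single x E r : E x -> (0 < r)%R ->
  ((2 * r) `^ s)%:E <= local_packing_cost i s E r.
Proof.
move=> Ex r0; rewrite /local_packing_cost ifF; last first.
  by apply/negbTE/set0P; exists x.
apply: ereal_sup_ubound; exists 1%N, (fun=> i x), (fun=> r); split=> //.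
- by move=> _; apply: subset_closure; exists x.
- by move=> _; rewrite r0 lexx.
- by move=> k l; rewrite !ord1 eqxx.
- by rewrite big_ord1.
Qed.

Lemma local_packing_cost_ge0 E r : (0 < r)%R -> 0 <= local_packing_cost i s E r.
Proof.
move=> r0; have [->|/set0P[x Ex]] := eqVneq E set0.
  by rewrite /local_packing_cost eqxx.
by apply: (le_trans _ (local_packing_cost_single Ex r0)); rewrite lee_fin powR_ge0.
Qed.

(* Balls of radii [b.2] and [c.2] that are disjoint in [X] have centres at
   distance more than [maxr b.2 c.2 >= b.2 / 2 + c.2 / 2]. *)
Lemma packing_pre_le_local_cost E r : (0 < r)%R ->
  packing_pre s r%:E E <= (2 `^ s)%:E * local_packing_cost i s E r.
Proof.
move=> r0; apply: ge_ereal_sup => _ [D [[_ tD] DE] <-].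
(* The cost only involves finite configurations, so finite subfamilies are treated one at a time. *)
apply: esum_ge0_le_finite => [b|A finA AD]; first by rewrite lee_fin powR_ge0.
have [->|/set0P[b0 Ab0]] := eqVneq A set0.
  by rewrite esum_set0 mule_ge0// ?local_packing_cost_ge0// lee_fin powR_ge0.
rewrite esum_fset//; last by move=> b _; rewrite lee_fin powR_ge0.
rewrite fsbig_finite//= (big_nth b0) big_mkord.
set S := finmap.enum_fset _.
have SA k : (k < size S)%N -> A (nth b0 S k).
  by move=> /(mem_nth b0); rewrite in_fset_set// inE.
have Sinj k l : (k < size S)%N -> (l < size S)%N ->
    k != l -> nth b0 S k != nth b0 S l.
  by move=> kS lS; rewrite nth_uniq// fset_uniq.
rewrite [leLHS](_ : _ = (2 `^ s)%:E *
    \sum_(k < size S) ((2 * ((nth b0 S k).2 / 2)) `^ s)%:E); last first.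
  rewrite ge0_sume_distrr; first last.
    by move=> k _; rewrite lee_fin powR_ge0.
  apply: eq_bigr => k _; have [_ b20 _] := DE _ (AD _ (SA k (ltn_ord k))).
  by rewrite -EFinM -powRM//; [congr (_ `^ _)%:E; lra|rewrite mulr_ge0// divr_ge0// ltW].
apply: lee_wpmul2l; first by rewrite lee_fin powR_ge0.
rewrite /local_packing_cost ifF; last first.
  by apply/negbTE/set0P; exists b0.1; have [] := DE _ (AD _ Ab0).
apply: ereal_sup_ubound.
exists (size S), (fun k => i (nth b0 S k).1), (fun k => (nth b0 S k).2 / 2)%R.
split=> //.
- have b0S : b0 \in S by rewrite in_fset_set// mem_set.
  by rewrite lt0n size_eq0; apply: contraTneq b0S => ->.
- move=> k; apply: subset_closure; exists (nth b0 S k).1 => //.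
  by have [] := DE _ (AD _ (SA k (ltn_ord k))).
- move=> k; have [_ b20] := DE _ (AD _ (SA k (ltn_ord k))).
  by rewrite lee_fin => b2r; rewrite divr_gt0//=; lra.
move=> k l kl; rewrite iso.
have [Ak Al] := (AD _ (SA k (ltn_ord k)), AD _ (SA l (ltn_ord l))).
have [[_ bk _] [_ bl _]] := (DE _ Ak, DE _ Al).
have := Sinj _ _ (ltn_ord k) (ltn_ord l) kl => nkl.
have := trivIset_mball_lt tD Ak Al nkl (ltW bl).
rewrite eq_sym in nkl; have := trivIset_mball_lt tD Al Ak nkl (ltW bk).
rewrite (metric_sym (nth b0 S l).1); lra.
Qed.

(** Each centre [x k] is moved to a point of [E] at distance less than [rho k / 4], and its radius
    is halved, which costs the factor [2 ^ s]. The centres stay more than three quarters of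
    [rho k + rho l] apart, so the halved closed balls in [X] are disjoint. *)
Lemma local_cost_config_packing E r N (x : 'I_N -> Y) (rho : 'I_N -> R) :
  (forall k, closure (i @` E) (x k)) -> (forall k, (0 < rho k <= r)%R) ->
  (forall k l, k != l -> (rho k + rho l <= mdist (x k) (x l))%R) ->
  exists D, [/\ is_packing D,
    forall b, D b -> [/\ E b.1, (0 < b.2)%R & (b.2 <= r / 2)%R] &
    \sum_(k < N) ((2 * rho k) `^ s)%:E = (2 `^ s)%:E * packing_weight s D].
Proof.
move=> xE rhor sep.
have /choice[z zP] k : exists z, E z /\ (mdist (i z) (x k) < rho k / 4)%R.
  have /andP[rk0 _] := rhor k.
  by have [|z Ez zk] := closure_image_approx (xE k) (e := (rho k / 4)%R);
    [rewrite divr_gt0|exists z].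
pose b k := (z k, rho k / 2)%R.
have zsep k l : k != l -> (rho k / 2 + rho l / 2 < mdist (z k) (z l))%R.
  move=> kl; have [[_ zk] [_ zl]] := (zP k, zP l).
  have [/andP[rk _] /andP[rl _]] := (rhor k, rhor l).
  have := sep k l kl; have := metric_triangle (x k) (i (z k)) (x l).
  have := metric_triangle (i (z k)) (i (z l)) (x l).
  rewrite iso (metric_sym (x k) (i _)); lra.
(* A packing is a set of labels: injectivity ensures that no term of the sum is lost. *)
have binj : injective b.
  move=> k l [zkl _]; apply/eqP/negP => /negP /zsep.
  have [/andP[rk _] /andP[rl _]] := (rhor k, rhor l).
  by rewrite zkl mdistxx; lra.
exists (range b); split.
- split; first exact/finite_set_countable/finite_image/finite_finset.
  apply/trivIsetP => _ _ [k _ <-] [l _ <-] bkl; apply/seteqP; split=> // y.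
  rewrite /mball /= => -[ky ly].
  have /zsep : k != l by apply: contra_neq bkl => ->.
  have := metric_triangle (z k) y (z l); rewrite (metric_sym y); lra.
- move=> _ [k _ <-] /=; have [Ez _] := zP k; have /andP[rk rkr] := rhor k.
  by split=> //; lra.
rewrite /packing_weight esum_image; last by move=> ? ? _ _; exact: binj.
rewrite esum_fset; [|exact: finite_finset|by move=> k _; rewrite lee_fin powR_ge0].
rewrite ge0_mule_fsumr; last by move=> k; rewrite lee_fin powR_ge0.
rewrite (fsbigE (index_enum 'I_N)) ?index_enum_uniq//; last first.
  by move=> k _; rewrite mem_index_enum.
apply: eq_big => [k|k _]; first by rewrite in_setT.
rewrite -EFinM -powRM//=.
- by congr (_ `^ _)%:E; lra.
- by have /andP[rk _] := rhor k; rewrite mulr_ge0// divr_ge0// ltW.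
Qed.

(** Used to derive finiteness of the costs from finiteness of the premeasure. *)
Lemma local_cost_le_packing_pre E r : (0 < r)%R ->
  local_packing_cost i s E r <= (2 `^ s)%:E * packing_pre s (r / 2)%:E E.
Proof.
move=> r0; rewrite /local_packing_cost; case: ifPn => [_|_].
  by rewrite mule_ge0 ?packing_pre_ge0// lee_fin powR_ge0.
apply: ge_ereal_sup => _ [N [x [rho [_ xE rhor sep ->]]]].
have [D [Dp DE ->]] := local_cost_config_packing xE rhor sep.
apply: lee_wpmul2l; first by rewrite lee_fin powR_ge0.
by apply: packing_weight_le_pre => // b /DE[]; rewrite lee_fin.
Qed.

(* The cost is positive, so when finite it is less than twice some packing sum. *)
Lemma local_cost_near_packing E r : (0 < r)%R ->
  local_packing_cost i s E r < +oo ->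
  exists D, [/\ is_packing D,
    forall b, D b -> [/\ E b.1, (0 < b.2)%R & (b.2 <= r / 2)%R] &
    local_packing_cost i s E r <= (2 * 2 `^ s)%:E * packing_weight s D].
Proof.
move=> r0 fin; have [->|/set0P[x0 Ex0]] := eqVneq E set0.
  exists set0; split=> //; first by split; [exact: countable0|move=> ? ? []].
  rewrite /local_packing_cost eqxx; apply: mule_ge0; last exact: packing_weight_ge0.
  by rewrite lee_fin mulr_ge0// powR_ge0.
have cpos := local_packing_cost_single Ex0 r0.
have c0 : 0 < local_packing_cost i s E r.
  by apply: (lt_le_trans _ cpos); rewrite lte_fin powR_gt0// mulr_gt0.
have cfin : local_packing_cost i s E r \is a fin_num by rewrite ge0_fin_numE// ltW.
pose c := fine (local_packing_cost i s E r).
have cE : local_packing_cost i s E r = c%:E by rewrite fineK.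
have c0' : (0 < c)%R by rewrite -lte_fin -cE.
have := cE; rewrite {1}/local_packing_cost ifF; last first.
  by apply/negbTE/set0P; exists x0.
set S := ereal_sup _ => SE.
have Sfin : S \is a fin_num by rewrite SE.
have [|_ [N [x [rho [_ xE rhor sep ->]]]]] := ub_ereal_sup_adherent (e := (c / 2)%R) _ Sfin.
  by rewrite divr_gt0.
have [D [Dp DE ->]] := local_cost_config_packing xE rhor sep.
rewrite -/S SE => lt; exists D; split=> //.
rewrite cE EFinM -muleA.
move: lt; case: (_ * packing_weight s D) => [w| |]//.
  by rewrite -EFinB -EFinM lte_fin lee_fin; lra.
by move=> _; rewrite gt0_muley ?leey// lte_fin.
Qed.

End local_cost.

(** * Disjoint families are countable when the premeasure is finite *)

Section packing_countability.
Context {R : realType} {X : metricType R}.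
Variables (s : R) (s0 : (0 < s)%R).
Implicit Types (r : R) (E F : set X) (D A : set (X * R)).
Local Open Scope ereal_scope.

(** Each ball weighs at least [(2 * r) ^ s], so an infinite family would contain finite packings of
    arbitrarily large weight. *)
Lemma finite_pre_finite_packing delta r E D : (0 < r)%R ->
  packing_pre s delta E < +oo ->
  trivIset D (fun b => mball b.1 b.2) ->
  (forall b, D b -> [/\ E b.1, (r <= b.2)%R & b.2%:E <= delta]) ->
  finite_set D.
Proof.
move=> r0 prefin tD DE; apply: contrapT => Dinf.
have rs0 : (0 < (2 * r) `^ s)%R by rewrite powR_gt0// mulr_gt0.
have prefn : packing_pre s delta E \is a fin_num.
  by rewrite ge0_fin_numE// packing_pre_ge0.
pose M := fine (packing_pre s delta E).
have [B BD] := infinite_set_fset (Num.truncn (M / (2 * r) `^ s)).+1 Dinf.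
set n := (X in (_ <= X)%N) => Bn.
have : packing_weight s [set` B] <= packing_pre s delta E.
  apply: packing_weight_le_pre => [|b /BD /DE[Eb rb bd]].
    by split; [exact/finite_set_countable/finite_fset|exact: sub_trivIset tD].
  by split=> //; exact: lt_le_trans rb.
rewrite /packing_weight esum_fset; last 2 first.
- exact: finite_fset.
- by move=> b _; rewrite lee_fin powR_ge0.
rewrite -fsbig_seq ?fset_uniq// sumEFin -(fineK prefn) lee_fin -/M.
apply/negP; rewrite -ltNge.
have /lt_le_trans : (M < n%:R * (2 * r) `^ s)%R.
  rewrite -ltr_pdivrMr//; apply: lt_le_trans (truncnS_gt _) _.
  by rewrite ler_nat.
apply; rewrite mulr_natl -iter_addr_0 -[n]count_predT -big_const_seq.
rewrite big_seq [leRHS]big_seq; apply: ler_sum => b /BD /DE[_ rb _].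
rewrite ge0_ler_powR ?nnegrE ?mulr_ge0 ?(ltW s0) ?(ltW r0)//.
- exact: le_trans (ltW r0) rb.
- by rewrite ler_pM2l.
Qed.

(** Since [X] may be nonseparable, countability comes from the premeasure: for each [n] only
    finitely many radii are at least [1 / (n + 1)]. *)
Lemma finite_pre_countable_packing delta E D :
  packing_pre s delta E < +oo ->
  trivIset D (fun b => mball b.1 b.2) ->
  (forall b, D b -> [/\ E b.1, (0 < b.2)%R & b.2%:E <= delta]) ->
  countable D.
Proof.
move=> prefin tD DE.
rewrite (_ : D = \bigcup_n (D `&` [set b | n.+1%:R^-1 <= b.2])%R).
  apply: bigcup_countable => // n _; apply: finite_set_countable.
  apply: (@finite_pre_finite_packing _ n.+1%:R^-1 _ _ _ prefin).
  - by rewrite invr_gt0.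
  - by apply: sub_trivIset tD => b [].
  - by move=> b [/DE[]].
apply/seteqP; split=> [b Db|b [n _ []]//]; have [_ b0 _] := DE _ Db.
exists (Num.truncn b.2^-1) => //; split=> //=.
by rewrite invf_ple ?posrE// ltW// truncnS_gt.
Qed.

End packing_countability.

(** * Vitali selection among balls with discrete radii *)

Section vitali.
Context {R : realType} {X : metricType R}.
Implicit Types (V D : set (X * R)) (v w : X * R).

Let meets v w := mball v.1 v.2 `&` mball w.1 w.2 !=set0.

Let meetsC v w : meets v w -> meets w v.
Proof. by rewrite /meets setIC. Qed.

(* Zorn's lemma on the disjoint families such that each ball of [V] meeting the
   family meets one of its balls of at least the same radius; a largest ball of
   [V] missing a maximal family could be added to it. *)
Lemma vitali_discrete_radii V (rad : nat -> R) :
  (forall k, 0 < rad k) -> (forall k l, (k <= l)%N -> rad l <= rad k) ->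
  (forall v, V v -> exists k, v.2 = rad k) ->
  exists D, [/\ D `<=` V, trivIset D (fun b => mball b.1 b.2) &
    forall v, V v -> exists w, [/\ D w, v.2 <= w.2 &
      mball v.1 v.2 `&` mball w.1 w.2 !=set0]].
Proof.
move=> rad0 rad_le Vrad.
have Vpos v : V v -> 0 <= v.2 by move=> /Vrad[k ->]; exact/ltW.
pose dominates D := forall v w, V v -> D w -> meets v w ->
  exists w', [/\ D w', v.2 <= w'.2 & meets v w'].
pose P D := [/\ D `<=` V, trivIset D (fun b => mball b.1 b.2) & dominates D].
have [|D [[DV tD domD] maxD]] := @Zorn_bigcup _ P.
  move=> F FP totF; split.
  - by move=> v [D /FP[DV _ _] /DV].
  - move=> v w [D FD Dv] [D' FD' D'w] vw.
    have [DD'|D'D] := totF _ _ FD FD'.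
      by have [_ + _] := FP _ FD'; apply=> //; exact: DD'.
    by have [_ + _] := FP _ FD; apply=> //; exact: D'D.
  - move=> v w Vv [D FD Dw] vw; have [_ _ domD] := FP _ FD.
    by have [w' [Dw' vw' m]] := domD _ _ Vv Dw vw; exists w'; split=> //; exists D.
exists D; split=> // v Vv; apply: contrapT => noD.
have nov : forall w, D w -> ~ meets v w.
  by move=> w Dw vw; apply: noD; have [w' ?] := domD _ _ Vv Dw vw; exists w'.
(* As [rad] is nonincreasing, the least bad index gives a largest ball of [V] missing [D]. *)
pose bad k := `[< exists u, [/\ V u, forall w, D w -> ~ meets u w & u.2 = rad k] >].
have [|k /asboolP[u [Vu Du uk]] kmin] := @ex_minnP bad.
  by have [k vk] := Vrad _ Vv; exists k; apply/asboolP; exists v.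
(* The ball [u] meets itself but misses [D], so adding it enlarges [D] strictly. *)
have uu : meets u u by exists u.1; split; exact: mball_center (Vpos _ Vu).
apply: (maxD (D `|` [set u])).
  split; first by move=> ? ?; left.
  by move=> /(_ u (or_intror erefl)) /Du; exact.
split.
- by move=> w [/DV//|->].
- move=> w w' [Dw|->] [Dw'|->]//.
  + exact: tD.
  + by move/meetsC/(Du _ Dw).
  + by move/(Du _ Dw').
move=> w w' Vw [Dw' ww'|-> wu].
  by have [w'' [? ? ?]] := domD _ _ Vw Dw' ww'; exists w''; split=> //; left.
have [[z [Dz wz]]|noDw] := pselect (exists z, D z /\ meets w z).
  by have [w'' [? ? ?]] := domD _ _ Vw Dz wz; exists w''; split=> //; left.
(* Here [w] misses [D], so its index is bad and minimality of [k] gives [w.2 <= u.2]. *)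
exists u; split=> //; first by right.
have [l wl] := Vrad _ Vw; rewrite wl uk; apply: rad_le; apply: kmin.
by apply/asboolP; exists w; split=> // z Dz wz; apply: noDw; exists z.
Qed.

End vitali.

(** * Scales at which the local cost is doubling *)

Section doubling.
Context {R : realType} {X Y : metricType R}.
Variables (i : X -> Y) (iso : forall x y, mdist (i x) (i y) = mdist x y).
Variables (s : R) (s0 : (0 < s)%R).
Implicit Types (r d : R) (E F : set X) (D A : set (X * R)).
Local Open Scope ereal_scope.

(* Iterating the failure of doubling down to radius [r = d / 4 ^ n] gives
   [(8 ^ n) `^ s * cost <= const], whereas a single ball already gives
   [cost >= (2 * d / 4 ^ n) `^ s]. *)
Lemma local_cost_doubling d E x : (0 < d)%R -> packing_pre s d%:E E < +oo ->
  E x -> exists k, let r := (d / 4 ^+ k.+1)%R in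
    local_packing_cost i s (E `&` mball x (2 * r)) (4 * r) <=
    (8 `^ s)%:E * local_packing_cost i s (E `&` mball x (r / 2)) r.
Proof.
move=> d0 prefin Ex; apply: contrapT => nodoubling.
pose r k := (d / 4 ^+ k)%R.
have r0 k : (0 < r k)%R by rewrite divr_gt0// exprn_gt0.
have rS k : (r k = 4 * r k.+1)%R.
  by rewrite /r exprS; field; rewrite expf_neq0.
pose H k := local_packing_cost i s (E `&` mball x (r k / 2)) (r k).
(* With [r k = 4 * r k.+1], the enlarged ball and scale at step [k.+1] are exactly those defining
   [H k]. *)
have HS k : (8 `^ s)%:E * H k.+1 < H k.
  rewrite ltNge; apply/negP => Hk; apply: nodoubling; exists k => /=.
  rewrite -/(r k.+1) -rS [X in mball x X](_ : _ = (r k / 2)%R)//.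
  by rewrite (rS k); lra.
have H0 k : ((8 ^+ k) `^ s)%:E * H k <= H 0%N.
  elim: k => [|k IH]; first by rewrite expr0 powR1 mul1e.
  apply: (le_trans _ IH).
  rewrite exprSr powRM ?exprn_ge0// EFinM -muleA.
  by rewrite lee_wpmul2l ?lee_fin ?powR_ge0// ltW.
have Hge k : ((2 * r k) `^ s)%:E <= H k.
  apply: (@local_packing_cost_single _ _ _ i s x) => //; split=> //.
  by rewrite /mball /= mdistxx divr_ge0// ltW.
have H0fin : H 0%N \is a fin_num.
  rewrite ge0_fin_numE ?local_packing_cost_ge0//.
  apply: le_lt_trans (local_cost_le_packing_pre iso s _ (r0 0%N)) _.
  apply: (@le_lt_trans _ _ ((2 `^ s)%:E * packing_pre s d%:E E)).
    apply: lee_wpmul2l; first by rewrite lee_fin powR_ge0.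
    apply: packing_pre_le; first exact: subIsetl.
    by rewrite lee_fin /r expr0; lra.
  by rewrite lte_mul_pinfty// ?lee_fin ?powR_ge0.
pose M := fine (H 0%N).
(* Since [k < 2 ^ k], this choice makes [(2 ^ k * (2 * d)) ^ s] at least [|M| + 1]; that quantity is
   [(8 ^ k * (2 * r k)) ^ s], which is at most [M]. *)
have [k Mk] : exists k, ((`|M| + 1) `^ s^-1 / (2 * d) < k%:R)%R.
  by exists (Num.truncn ((`|M| + 1) `^ s^-1 / (2 * d))).+1; exact: truncnS_gt.
have : ((8 ^+ k * (2 * r k)) `^ s <= M)%R.
  rewrite -lee_fin /M fineK// powRM ?exprn_ge0 ?mulr_ge0 ?(ltW (r0 k)) ?(ltW d0)//.
  by apply: (le_trans _ (H0 k)); rewrite EFinM lee_wpmul2l ?lee_fin ?powR_ge0.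
apply/negP; rewrite -ltNge.
have -> : (8 ^+ k * (2 * r k) = 2 ^+ k * (2 * d))%R.
  rewrite /r (_ : 8 = 2 * 4)%R; last by lra.
  by rewrite exprMn; field; rewrite expf_neq0.
apply: (@lt_le_trans _ _ (`|M| + 1)%R); first by rewrite ltr_pwDr// ler_norm.
have MM : (`|M| + 1 = ((`|M| + 1) `^ s^-1) `^ s)%R.
  by rewrite -powRrM mulVf ?gt_eqF// powRr1// addr_ge0.
rewrite {1}MM ge0_ler_powR ?nnegrE ?powR_ge0 ?(ltW s0)//.
  by rewrite !mulr_ge0 ?exprn_ge0// ltW.
rewrite -ler_pdivrMr ?mulr_gt0//.
apply: le_trans (ltW Mk) _.
by rewrite -natrX ler_nat ltnW// ltn_expl.
Qed.

End doubling.

(** * Labelled covers: countable index sets and subadditivity *)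

Section labelled_covers.
Context {R : realType} {X Y : metricType R}.
Variables (i : X -> Y) (s : R).
Implicit Types (r d delta : R) (E F : set X).
Local Open Scope ereal_scope.

Lemma diam_le E r : (0 <= r)%R ->
  (forall x y, E x -> E y -> (mdist x y <= r)%R) -> diam E <= r%:E.
Proof.
move=> r0 Er; apply: ge_ereal_sup => _ [->|[[x y] [/= Ex Ey] <-]].
  by rewrite lee_fin.
by rewrite lee_fin; exact: Er.
Qed.

Lemma labelled_packing_pre_ge0 delta F : 0 <= labelled_packing_pre i s delta F.
Proof.
apply: le_ereal_inf_tmp => _ [c [_ cP] <-]; apply: nneseries_ge0 => j _ _.
by have [_ _ ?] := cP j; exact: local_packing_cost_ge0.
Qed.

Lemma labelled_packing_measure_ge0 F : 0 <= labelled_packing_measure i s F.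
Proof.
apply: (le_trans (labelled_packing_pre_ge0 2^-1 F)).
by apply: ereal_sup_ubound; exists 2^-1%R => //=; lra.
Qed.

Lemma labelled_packing_pre_le_esum {T : choiceType} (D : set T)
    (E_ : T -> set X) (r : T -> R) delta F : (0 < delta)%R -> countable D ->
  F `<=` \bigcup_(t in D) E_ t ->
  (forall t, D t -> [/\ diam (E_ t) <= (r t)%:E, (r t <= delta)%R & (0 < r t)%R]) ->
  labelled_packing_pre i s delta F <=
  \esum_(t in D) local_packing_cost i s (E_ t) (r t).
Proof.
move=> delta0 /countable_injP[f finj] FE Er.
have /choice[c cP] n : exists c : set X * R,
    (forall t, D t -> f t = n -> c = (E_ t, r t)) /\
    (~ (f @` D) n -> c = (set0, delta)).
  have [[t Dt ftn]|nDn] := pselect ((f @` D) n).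
    exists (E_ t, r t); split=> [u Du fun_n|[]]; last by exists t.
    by rewrite (finj u t) ?inE// fun_n ftn.
  by exists (set0, delta); split=> // t Dt ftn; case: nDn; exists t.
have cD t : D t -> c (f t) = (E_ t, r t) by move=> Dt; have [/(_ t Dt erefl)] := cP (f t).
have cadm n : [/\ diam (c n).1 <= (c n).2%:E, ((c n).2 <= delta)%R & (0 < (c n).2)%R].
  have [[t Dt <-]|nDn] := pselect ((f @` D) n); first by rewrite cD//; exact: Er.
  have [_ /(_ nDn)->] := cP n; split=> //=.
  by apply: diam_le; [exact: ltW|move=> ? ? []].
apply: (@le_trans _ _
    (\sum_(0 <= n <oo) local_packing_cost i s (c n).1 (c n).2)).
  apply: ereal_inf_lbound; exists (fun n => (c n).1, fun n => (c n).2)%R => //.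
  split=> // x /FE[t Dt Ex]; exists (f t) => //=; by rewrite cD.
rewrite nneseries_esumT; last first.
  by move=> n; have [_ _ ?] := cadm n; exact: local_packing_cost_ge0.
rewrite [leRHS](eq_esum (b := fun t =>
  local_packing_cost i s (c (f t)).1 (c (f t)).2)); last by move=> t /cD ->.
rewrite -(@esum_image _ _ _ D f
  (fun n => local_packing_cost i s (c n).1 (c n).2) finj).
rewrite [leRHS]esum_mkcond; apply: le_esum => n _.
case: ifPn => // /negP; rewrite inE => nDn; have [_ /(_ nDn)->] := cP n.
by rewrite /local_packing_cost eqxx.
Qed.

(** Covers of the [F_ j] that are optimal up to [e / 2 ^ (j + 1)] combine into one cover indexed by
    pairs. *)
Lemma labelled_packing_pre_sigma_subadditive delta F (F_ : nat -> set X) :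
  (0 < delta)%R -> F `<=` \bigcup_j F_ j ->
  labelled_packing_pre i s delta F <=
  \sum_(0 <= j <oo) labelled_packing_pre i s delta (F_ j).
Proof.
move=> delta0 FF; have M0 := labelled_packing_pre_ge0 delta.
have [[j Mj]|Mfin] := pselect (exists j, labelled_packing_pre i s delta (F_ j) = +oo).
  by rewrite (nneseries_pinfty _ _ Mj)// ?leey.
apply/lee_addgt0Pr => e e0.
apply: (le_trans _ (epsilon_trick xpredT _ (ltW e0))) => //.
have /choice[c cP] j : exists c : (nat -> set X) * (nat -> R),
    [/\ F_ j `<=` \bigcup_k c.1 k,
      forall k, [/\ diam (c.1 k) <= (c.2 k)%:E, (c.2 k <= delta)%R & (0 < c.2 k)%R] &
      \sum_(0 <= k <oo) local_packing_cost i s (c.1 k) (c.2 k) <=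
      labelled_packing_pre i s delta (F_ j) + (e / (2 ^ j.+1)%:R)%:E].
  have [||_ [c [Fc cP] <-] clt] := @lb_ereal_inf_adherent _ [set
     \sum_(0 <= j <oo) local_packing_cost i s (c.1 j) (c.2 j) |
    c in [set c : (nat -> set X) * (nat -> R) |
      F_ j `<=` \bigcup_j c.1 j /\
      forall j, [/\ diam (c.1 j) <= (c.2 j)%:E,
                    (c.2 j <= delta)%R & (0 < c.2 j)%R]]] (e / (2 ^ j.+1)%:R)%R.
  - by rewrite divr_gt0// ltr0n expn_gt0.
  - rewrite -/(labelled_packing_pre i s delta (F_ j)) ge0_fin_numE//.
    by rewrite ltey; apply/eqP => Mj; apply: Mfin; exists j.
  by exists c; split=> //; exact: ltW.
have cost0 j k : 0 <= local_packing_cost i s ((c j).1 k) ((c j).2 k).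
  by have [_ /(_ k)[_ _ ?] _] := cP j; exact: local_packing_cost_ge0.
apply: (@le_trans _ _ (\sum_(0 <= j <oo) \sum_(0 <= k <oo)
    local_packing_cost i s ((c j).1 k) ((c j).2 k))); last first.
  apply: lee_nneseries => [j _ _|j _]; last by have [] := cP j.
  exact: nneseries_ge0.
rewrite nneseries_esumT; last by move=> j; exact: nneseries_ge0.
under eq_esum do rewrite nneseries_esumT//.
rewrite esum_esum//.
apply: (@labelled_packing_pre_le_esum _ _ (fun p => (c p.1).1 p.2)
  (fun p => (c p.1).2 p.2)) => //.
- exact: countableP.
- move=> x /FF[j _]; have [Fc _ _] := cP j; move=> /Fc[k _ Ex].
  by exists (j, k).
- by move=> [j k] _ /=; have [_ /(_ k)] := cP j.
Qed.

End labelled_covers.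

(** * Comparison of the two measures *)

Section comparison.
Context {R : realType} {X Y : metricType R}.
Variables (i : X -> Y) (iso : forall x y, mdist (i x) (i y) = mdist x y).
Variables (s : R) (s0 : (0 < s)%R).
Implicit Types (r d delta : R) (E F : set X) (D A : set (X * R)).
Local Open Scope ereal_scope.

(** Centres within [v.2 / 2] of [v.1] and radii at most [v.2 / 2] keep the balls of [P v] inside the
    ball [v], so packings attached to different balls of [D] do not interfere. *)
Lemma packing_pre_merge d E D (P : X * R -> set (X * R)) :
  countable D -> trivIset D (fun b => mball b.1 b.2) ->
  (forall v, D v -> (v.2 <= d)%R) ->
  (forall v, D v -> is_packing (P v)) ->
  (forall v b, D v -> P v b ->
    [/\ E b.1, mball v.1 (v.2 / 2) b.1, (0 < b.2)%R & (b.2 <= v.2 / 2)%R]) ->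
  \esum_(v in D) packing_weight s (P v) <= packing_pre s d%:E E.
Proof.
move=> cD tD Dd Ppack PD.
have sub v b y : D v -> P v b -> mball b.1 b.2 y -> mball v.1 v.2 y.
  rewrite /mball /= => Dv Pvb by_; have [_ + b0 bv] := PD _ _ Dv Pvb.
  rewrite /mball /=; have := metric_triangle v.1 b.1 y; lra.
have own v w b c : D v -> D w -> P v b -> P w c ->
    mball b.1 b.2 `&` mball c.1 c.2 !=set0 -> v = w.
  move=> Dv Dw Pvb Pwc [y [by_ cy]]; apply: tD => //.
  by exists y; split; [exact: sub Pvb by_|exact: sub Pwc cy].
rewrite /packing_weight esum_bigcup_disjoint; first last.
- move=> v w Dv Dw [b [Pvb Pwb]]; apply: (own v w b b) => //.
  by have [_ _ /ltW b0 _] := PD _ _ Dv Pvb; exists b.1; split; exact: mball_center.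
- by move=> b; rewrite lee_fin powR_ge0.
apply: packing_weight_le_pre => [|b [v Dv Pvb]].
  split; first by apply: bigcup_countable => // v /Ppack[].
  move=> b c [v Dv Pvb] [w Dw Pwc] bc.
  have vw := own _ _ _ _ Dv Dw Pvb Pwc bc; subst w.
  by have [_ +] := Ppack _ Dv; apply.
have [Eb _ b0 bv] := PD _ _ Dv Pvb; split=> //; rewrite lee_fin.
by have := Dd _ Dv; lra.
Qed.

Lemma labelled_packing_pre_le_packing_pre d E : (0 < d)%R ->
  labelled_packing_pre i s d E <=
  (8 `^ s * (2 * 2 `^ s))%:E * packing_pre s d%:E E.
Proof.
move=> d0; have K0 : (0 < 8 `^ s * (2 * 2 `^ s) :> R)%R.
  by rewrite !mulr_gt0// powR_gt0.
have [->|] := eqVneq (packing_pre s d%:E E) +oo.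
  by rewrite gt0_muley ?leey// lte_fin.
rewrite -ltey => prefin.
(* Starting at [d / 4] keeps the labels [4 * rad k] of the enlarged balls at most [d]. *)
pose rad k : R := (d / 4 ^+ k.+1)%R.
have rad0 k : (0 < rad k)%R by rewrite divr_gt0// exprn_gt0.
have rad_le k l : (k <= l)%N -> (rad l <= rad k)%R.
  move=> kl; rewrite ler_pM2l// lef_pV2 ?posrE ?exprn_gt0//.
  by rewrite ler_weXn2l//; lra.
have radd k : (4 * rad k <= d)%R.
  rewrite /rad mulrC -mulrA ger_pMr// exprS invfM -mulrA.
  by rewrite mulrCA mulVf// mulr1 invf_le1 ?exprn_gt0// exprn_ege1//; lra.
pose V := [set v : X * R | [/\ E v.1, exists k, v.2 = rad k &
  local_packing_cost i s (E `&` mball v.1 (2 * v.2)) (4 * v.2) <=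
  (8 `^ s)%:E * local_packing_cost i s (E `&` mball v.1 (v.2 / 2)) v.2]].
have [|D [DV tD domD]] := vitali_discrete_radii (V := V) rad0 rad_le.
  by move=> v [].
have D0 v : D v -> (0 < v.2)%R by move=> /DV[_ [k ->]].
have Dd v : D v -> (4 * v.2 <= d)%R by move=> /DV[_ [k ->]].
have cD : countable D.
  apply: (finite_pre_countable_packing s0 prefin tD) => v Dv.
  have [Ev _ _] := DV _ Dv; split=> //; first exact: D0.
  by rewrite lee_fin; have := D0 _ Dv; have := Dd _ Dv; lra.
have /choice[P PP] v : exists B, D v -> [/\ is_packing B,
    forall b, B b -> [/\ (E `&` mball v.1 (v.2 / 2)) b.1, (0 < b.2)%R & (b.2 <= v.2 / 2)%R] &
    local_packing_cost i s (E `&` mball v.1 (v.2 / 2)) v.2 <=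
      (2 * 2 `^ s)%:E * packing_weight s B].
  have [Dv|] := pselect (D v); last by exists set0.
  have [||B HB] := @local_cost_near_packing _ _ _ _ iso s (E `&` mball v.1 (v.2 / 2)) v.2.
  - exact: D0.
  - apply: le_lt_trans (local_cost_le_packing_pre iso s _ (D0 _ Dv)) _.
    rewrite lte_mul_pinfty ?lee_fin ?powR_ge0//.
    apply: le_lt_trans prefin; apply: packing_pre_le; first exact: subIsetl.
    by rewrite lee_fin; have := D0 _ Dv; have := Dd _ Dv; lra.
  by exists B.
(* The ball at [x] meets a selected ball [w] of no smaller radius, so [x] is within [2 * w.2] of
   [w.1]. The enlarged ball has diameter at most [4 * w.2], its label. *)
apply: (@le_trans _ _ (\esum_(v in D)
    local_packing_cost i s (E `&` mball v.1 (2 * v.2)) (4 * v.2))).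
  apply: labelled_packing_pre_le_esum => // [x Ex|v Dv].
    have [k xk] := local_cost_doubling iso s0 d0 prefin Ex.
    have [|w [Dw /= vw [y [/= xy wy]]]] := domD (x, rad k).
      by split=> //; exists k.
    exists w => //; split=> //; move: xy wy; rewrite /mball /=.
    have := metric_triangle w.1 y x; rewrite (metric_sym y x); lra.
  split; [|exact: Dd|by rewrite mulr_gt0// D0].
  apply: diam_le => [|x y [_ xv] [_ yv]]; first by rewrite mulr_ge0// ltW// D0.
  move: xv yv; rewrite /mball /=.
  have := metric_triangle x v.1 y; rewrite (metric_sym x v.1); lra.
(* Doubling contributes [8 ^ s]; passing from the cost to a nearly optimal packing contributes
   [2 * 2 ^ s]. *)
apply: (@le_trans _ _ (\esum_(v in D)
    ((8 `^ s * (2 * 2 `^ s))%:E * packing_weight s (P v)))).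
  apply: le_esum => v Dv; have [_ _ Vv] := DV _ Dv; apply: (le_trans Vv).
  have [_ _ Pv] := PP _ Dv.
  by rewrite EFinM -muleA lee_wpmul2l// lee_fin powR_ge0.
apply: le_trans (ge0_le_esumZl _ _ _) _; [exact: ltW| |].
  by move=> v; exact: packing_weight_ge0.
apply: lee_wpmul2l; first by rewrite lee_fin ltW.
apply: packing_pre_merge => //.
- by move=> v Dv; have := D0 _ Dv; have := Dd _ Dv; lra.
- by move=> v /PP[].
- by move=> v b /PP[_ Pv _] /Pv[[? ?] ? ?].
Qed.

Lemma labelled_packing_pre_le_packing_pre0 delta E : (0 < delta)%R ->
  labelled_packing_pre i s delta E <=
  (8 `^ s * (2 * 2 `^ s))%:E * packing_pre0 s E.
Proof.
move=> delta0; have K0 : (0 < 8 `^ s * (2 * 2 `^ s) :> R)%R.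
  by rewrite !mulr_gt0// powR_gt0.
rewrite /packing_pre0 -ereal_inf_pZl//.
apply: le_ereal_inf_tmp => _ [_ [d d0 <-] <-].
(* The constant does not depend on the scale, so both scales can be shrunk to a common finite [e],
   even when [d] is infinite. *)
have [e [e0 edelta ed]] : exists e : R, [/\ (0 < e)%R, (e <= delta)%R & e%:E <= d].
  case: d d0 => [d /=|_|//]; last by exists delta; rewrite leey.
  rewrite lte_fin => d0; exists (Num.min d delta).
  by rewrite lt_min d0 delta0 ge_min lexx orbT lee_fin ge_min lexx.
apply: (le_trans (labelled_packing_pre_le _ _ _ edelta)).
apply: (le_trans (labelled_packing_pre_le_packing_pre E e0)).
apply: lee_wpmul2l; first by rewrite lee_fin ltW.
exact: packing_pre_le.
Qed.

Lemma labelled_packing_measure_le F :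
  labelled_packing_measure i s F <=
  (8 `^ s * (2 * 2 `^ s))%:E * packing_measure s F.
Proof.
have K0 : (0 < 8 `^ s * (2 * 2 `^ s) :> R)%R.
  by rewrite !mulr_gt0// powR_gt0.
apply: ge_ereal_sup => _ [delta /= /andP[delta0 _] <-].
rewrite /packing_measure -ereal_inf_pZl//.
apply: le_ereal_inf_tmp => _ [_ [F_ FF <-] <-].
apply: (le_trans (labelled_packing_pre_sigma_subadditive i s delta0 FF)).
rewrite -nneseriesZl; last by move=> j _; exact: packing_pre0_ge0.
apply: lee_nneseries => [j _ _|j _]; first exact: labelled_packing_pre_ge0.
exact: labelled_packing_pre_le_packing_pre0.
Qed.

(** The sets of a labelled cover also compete in the definition of the packing measure, and the
    premeasure of each at the scale of its label is at most [2 ^ s] times its cost. *)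
Lemma packing_measure_le F :
  packing_measure s F <= (2 `^ s)%:E * labelled_packing_measure i s F.
Proof.
apply: (@le_trans _ _ ((2 `^ s)%:E * labelled_packing_pre i s 2^-1 F)); last first.
  rewrite lee_wpmul2l ?lee_fin ?powR_ge0//.
  by apply: ereal_sup_ubound; exists 2^-1%R => //=; lra.
rewrite /labelled_packing_pre -ereal_inf_pZl ?powR_gt0//.
apply: le_ereal_inf_tmp => _ [_ [c [Fc cP] <-] <-].
apply: (@le_trans _ _ (\sum_(0 <= j <oo) packing_pre0 s (c.1 j))).
  by apply: ereal_inf_lbound; exists c.1.
rewrite -nneseriesZl; last first.
  by move=> j _; have [_ _ ?] := cP j; exact: local_packing_cost_ge0.
apply: lee_nneseries => [j _ _|j _]; first exact: packing_pre0_ge0.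
have [_ _ c0] := cP j.
apply: (le_trans _ (packing_pre_le_local_cost iso s _ c0)).
by apply: ereal_inf_lbound; exists (c.2 j)%:E.
Qed.

Lemma labelled_packing_measure_eq0 F :
  labelled_packing_measure i s F = 0 <-> packing_measure s F = 0.
Proof.
split=> F0; apply/eqP; rewrite eq_le.
- by rewrite packing_measure_ge0 andbT (le_trans (packing_measure_le F))// F0 mule0.
- rewrite labelled_packing_measure_ge0 andbT.
  by rewrite (le_trans (labelled_packing_measure_le F))// F0 mule0.
Qed.

End comparison.

Theorem theorem1p1 (R : realType) :
  (forall s : R, 0 < s -> exists C : R, 0 < C /\
    forall (X Y : metricType R) (i : X -> Y), is_completion i ->
    forall F : set X,
      ((2 `^ (- s))%:E * packing_measure s F
         <= labelled_packing_measure i s F)%E /\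
      (labelled_packing_measure i s F <= C%:E * packing_measure s F)%E) /\
  (forall (X Y : metricType R) (i : X -> Y), is_completion i ->
    forall F : set X, labelled_packing_dim i F = packing_dim F).
Proof.
split=> [s s0|X Y i [iso _ _] F].
  exists (8 `^ s * (2 * 2 `^ s)); split; first by rewrite !mulr_gt0// powR_gt0.
  move=> X Y i [iso _ _] F; split; last exact: labelled_packing_measure_le.
  by rewrite powRN lee_pdivrMl ?powR_gt0//; exact: packing_measure_le.
(* Both measures vanish for the same exponents [t], so the two infima are over the same set. *)
congr ereal_inf; congr image; apply/seteqP; split=> t [t0 Ft]; split=> //.
  exact/(labelled_packing_measure_eq0 iso t0).
exact/(labelled_packing_measure_eq0 iso t0).
Qed.
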